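(* For $\beta_2\in\mathbb{R}$ consider the two-star variational problem at edge density $\frac12$: $$\psi\left(\tfrac12,\beta_2\right)=\sup\left\{\beta_2\int_0^1\left(\int_0^1h(x,y)\,dy\right)^2dx-\frac12\iint_{[0,1]^2}I(h(x,y))\,dx\,dy\;:\;h\text{ a graphon},\ \iint_{[0,1]^2}h(x,y)\,dx\,dy=\tfrac12\right\}.$$ The optimizing graphon is uniform if $\beta_2\le2$, and it is non-uniform if $\beta_2>2$.
   Context: A graphon is a measurable function $h:[0,1]^2\to[0,1]$ with $h(x,y)=h(y,x)$. $I(x)=x\log x+(1-x)\log(1-x)$ on $[0,1]$, with $0\log 0=0$. An optimizing graphon is a graphon satisfying the constraint and attaining the supremum. ''The optimizing graphon is uniform'' means that every optimizing graphon is a.e. constant (hence a.e. equal to $\frac12$); ''non-uniform'' means that no optimizing graphon is a.e. constant. *)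

(* Defs.v *)
From HB Require Import structures.
From mathcomp Require Import all_boot all_order all_algebra.
From mathcomp Require Import all_classical all_reals all_analysis.

Set Implicit Arguments.
Unset Strict Implicit.
Unset Printing Implicit Defensive.

Import Order.TTheory GRing.Theory Num.Theory.
Import numFieldNormedType.Exports.

Local Open Scope classical_set_scope.
Local Open Scope ring_scope.

Section TwoStar.
Context {R : realType}.

Local Notation mu := (@lebesgue_measure R).

Definition unit_square : set (R * R) := `[0, 1]%classic `*` `[0, 1]%classic.

(* Only the values of h on the unit square matter. Measurability is with
   respect to the (Borel) product sigma-algebra. *)
Definition graphon (h : R * R -> R) : Prop :=
  [/\ measurable_fun unit_square h,
      (forall z, unit_square z -> 0 <= h z <= 1) &
      (forall x y, unit_square (x, y) -> h (x, y) = h (y, x))].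

(* The convention 0 log 0 = 0 holds because ln is total. *)
Definition Ifun (x : R) : R := x * ln x + (1 - x) * ln (1 - x).

Definition edge_density (h : R * R -> R) : R :=
  \int[(mu \x mu)%E]_(z in unit_square) h z.

Definition two_star_density (h : R * R -> R) : R :=
  \int[mu]_(x in `[0, 1]) (\int[mu]_(y in `[0, 1]) h (x, y)) ^+ 2.

Definition objective (beta2 : R) (h : R * R -> R) : R :=
  beta2 * two_star_density h
  - 2^-1 * \int[(mu \x mu)%E]_(z in unit_square) Ifun (h z).

Definition admissible (e : R) (h : R * R -> R) : Prop :=
  graphon h /\ edge_density h = e.

Definition psi (e beta2 : R) : \bar R :=
  ereal_sup [set (objective beta2 h)%:E | h in admissible e].

Definition optimizing_graphon (e beta2 : R) (h : R * R -> R) : Prop :=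
  admissible e h /\ (objective beta2 h)%:E = psi e beta2.

Definition ae_constant (h : R * R -> R) : Prop :=
  exists c : R, {ae (mu \x mu)%E, forall z, unit_square z -> h z = c}.

Definition optimizer_uniform (e beta2 : R) : Prop :=
  forall h, optimizing_graphon e beta2 h -> ae_constant h.

Definition optimizer_nonuniform (e beta2 : R) : Prop :=
  forall h, optimizing_graphon e beta2 h -> ~ ae_constant h.

End TwoStar.

(* Main.v *)
(* Write h = 1/2 + g and let d(x) be the integral of g(x, .), so that d has
   integral 0. Integrating (g(x, y) - d(x) - d(y))^2 >= 0 gives
   2 int d^2 <= iint g^2, while I(1/2 + t) >= - log 2 + 2 t^2 with equality only
   at t = 0. Hence for beta_2 <= 2 the objective is at most its value at the
   constant graphon 1/2, with equality only there. For beta_2 > 2 the constant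
   1/2 is beaten by h(x, y) = 1/2 + eps (s(x) + s(y)), where s takes the values
   1 and -1 on sets of measure 1/2: this g makes 2 int d^2 = iint g^2, and
   I(1/2 + t) = - log 2 + 2 t^2 + o(t^2). *)
Require Import Defs.
From mathcomp Require Import all_boot all_order all_algebra.
From mathcomp Require Import all_classical all_reals all_analysis.
From mathcomp Require Import measurable_realfun.
From mathcomp Require Import ring lra.
Import Order.TTheory GRing.Theory Num.Theory.
Import numFieldNormedType.Exports.
Local Open Scope classical_set_scope.
Local Open Scope ring_scope.

(** * Calculus of the entropy function in one variable *)

Lemma is_derive_ln1D (R : realType) (x : R) : 0 < 1 + x ->
  is_derive x (1 : R) (fun u => ln (1 + u)) (1 + x)^-1.
Proof.
move=> p; rewrite -[X in is_derive _ _ _ X]mulr1.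
apply: (@is_derive1_comp R (@ln R) (fun u : R => 1 + u)).
  exact: is_derive1_ln.
by apply: is_derive_eq; lra.
Qed.

Lemma is_derive_ln1B (R : realType) (x : R) : 0 < 1 - x ->
  is_derive x (1 : R) (fun u => ln (1 - u)) (- (1 - x)^-1).
Proof.
move=> p; rewrite -mulrN1.
apply: (@is_derive1_comp R (@ln R) (fun u : R => 1 - u)).
  exact: is_derive1_ln.
by apply: is_derive_eq; lra.
Qed.

(** Up to an affine change this is [Ifun] at [(1 + u) / 2] minus a parabola. The value [l = 1]
    serves the quadratic lower bound on [Ifun]; values [l > 1] serve to show that its constant is
    sharp. *)
Lemma is_derive_entropy (R : realType) (l x : R) : -1 < x < 1 ->
  is_derive x (1 : R)
    (fun u => (1 + u) * ln (1 + u) + (1 - u) * ln (1 - u) - l * u ^+ 2)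
    (ln (1 + x) - ln (1 - x) - 2 * l * x).
Proof.
move=> /andP[x1 x2].
have d1 : is_derive x 1 (fun u : R => ln (1 + u)) (1 + x)^-1.
  by apply: is_derive_ln1D; lra.
have d2 : is_derive x 1 (fun u : R => ln (1 - u)) (- (1 - x)^-1).
  by apply: is_derive_ln1B; lra.
apply: is_derive_eq.
rewrite /GRing.scale /= /cst /=.
field; lra.
Qed.

Lemma is_derive_ln_ratio (R : realType) (x : R) : -1 < x < 1 ->
  is_derive x (1 : R) (fun u => ln (1 + u) - ln (1 - u) - 2 * u)
    ((1 + x)^-1 + (1 - x)^-1 - 2).
Proof.
move=> /andP[x1 x2].
have d1 : is_derive x 1 (fun u : R => ln (1 + u)) (1 + x)^-1.
  by apply: is_derive_ln1D; lra.
have d2 : is_derive x 1 (fun u : R => ln (1 - u)) (- (1 - x)^-1).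
  by apply: is_derive_ln1B; lra.
apply: is_derive_eq.
rewrite /GRing.scale /= /cst /=.
by field; lra.
Qed.

Lemma MVT_from0 (R : realType) (f df : R -> R) (u : R) : 0 < u < 1 ->
  (forall x : R, -1 < x < 1 -> is_derive x (1 : R) f (df x)) ->
  exists2 c, 0 < c < u & f u - f 0 = df c * u.
Proof.
move=> /andP[u0 u1] dfx.
have [||c cu ->] := @MVT R f df 0 u u0.
- by move=> x; rewrite in_itv/= => /andP[? ?]; apply: dfx; lra.
- apply: derivable_within_continuous => x; rewrite in_itv/= => /andP[? ?].
  have : -1 < x < 1 by lra.
  by move/dfx => [].
- by exists c => //; rewrite subr0.
Qed.

(** The difference of the two sides vanishes at 0 and has derivative [2 * c ^+ 2 / (1 - c ^+ 2)],
    which is positive. *)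
Lemma ln_ratio_gt (R : realType) (u : R) : 0 < u < 1 -> 2 * u < ln (1 + u) - ln (1 - u).
Proof.
move=> u01.
have [c /andP[c0 cu] E] := MVT_from0 _ _ _ _ u01 (@is_derive_ln_ratio R).
move: E; rewrite addr0 subr0 ln1 mulr0 !subr0 => E.
rewrite -subr_gt0 E; apply: mulr_gt0; last lra.
have -> : (1 + c)^-1 + (1 - c)^-1 - 2 = 2 * c ^+ 2 / ((1 + c) * (1 - c)).
  by field; lra.
by apply: divr_gt0; [nra|apply: mulr_gt0; lra].
Qed.

Lemma entropy_gt (R : realType) (u : R) : 0 < u < 1 ->
  u ^+ 2 < (1 + u) * ln (1 + u) + (1 - u) * ln (1 - u).
Proof.
move=> u01.
have [c /andP[c0 cu] E] := MVT_from0 _ _ _ _ u01 (@is_derive_entropy R 1).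
move: E; rewrite addr0 subr0 ln1 !mulr0 addr0 expr0n/= mulr0 !subr0 mul1r => E.
rewrite -subr_gt0 E; apply: mulr_gt0; last lra.
have := @ln_ratio_gt R c; lra.
Qed.

(** Replaces the second-order expansion of the entropy at 0 by one explicit point where the upper
    bound holds. *)
Lemma entropy_lt (R : realType) (l : R) : 1 < l ->
  exists2 u, 0 < u < 1 &
    (1 + u) * ln (1 + u) + (1 - u) * ln (1 - u) < l * u ^+ 2.
Proof.
(* Chosen so that [c < u] means [1 + (1 - c)^-1 < 2 * l]. *)
move=> l1; pose u : R := 1 - (2 * l - 1)^-1.
have p : 0 < (2 * l - 1)^-1 by rewrite invr_gt0; lra.
have p1 : (2 * l - 1)^-1 < 1 by rewrite invf_lt1; lra.
have u01 : 0 < u < 1 by rewrite /u; lra.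
exists u => //.
have [c /andP[c0 cu] E] := MVT_from0 _ _ _ _ u01 (@is_derive_entropy R l).
move: E; rewrite addr0 subr0 ln1 !mulr0 addr0 expr0n/= mulr0 !subr0 => E.
rewrite -subr_lt0 E pmulr_llt0; last lra.
(* Both logarithms are bounded by [ln (1 + t) <= t], the second after inversion. The derivative at
   [c] is then at most [c * (1 + (1 - c)^-1 - 2 * l)], which is negative. *)
have h1 : ln (1 + c) <= c by apply: le_ln1Dx; lra.
have h2 : - ln (1 - c) <= (1 - c)^-1 - 1.
  rewrite -lnV ?posrE; last lra.
  have -> : (1 - c)^-1 = 1 + ((1 - c)^-1 - 1) by ring.
  rewrite [X in _ <= X - 1]addrC addrK.
  apply: le_ln1Dx.
  have : 0 < (1 - c)^-1 by rewrite invr_gt0; lra.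
  lra.
have h3 : (1 - c)^-1 < 2 * l - 1.
  rewrite -[ltRHS]invrK ltf_pV2 ?posrE //; rewrite /u in cu; lra.
have h4 : (1 - c)^-1 - 1 = c * (1 - c)^-1 by field; lra.
nra.
Qed.

Lemma Ifun_half (R : realType) : Ifun (2^-1 : R) = - ln 2.
Proof.
have -> : Ifun (2^-1 : R) = ln 2^-1.
  by rewrite /Ifun (_ : 1 - 2^-1 = 2^-1 :> R); [field|field].
by rewrite lnV ?posrE.
Qed.

Lemma IfunC (R : realType) (x : R) : Ifun (1 - x) = Ifun x.
Proof. by rewrite /Ifun opprB addrCA subrr addr0 addrC. Qed.

Lemma Ifun_entropy (R : realType) (u : R) : -1 < u < 1 ->
  Ifun ((1 + u) / 2) =
  ((1 + u) * ln (1 + u) + (1 - u) * ln (1 - u)) / 2 - ln 2.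
Proof.
move=> u1; rewrite /Ifun (_ : 1 - (1 + u) / 2 = (1 - u) / 2); last by field.
by rewrite !ln_div ?posrE//; [field|lra..].
Qed.

(** Both sides are invariant under [x] to [1 - x], so [x > 1/2] may be assumed; then [u = 2 * x - 1]
    reduces the claim to [entropy_gt]. *)
Lemma Ifun_gt (R : realType) (x : R) : 0 <= x <= 1 -> x != 2^-1 ->
  - ln 2 + 2 * (x - 2^-1) ^+ 2 < Ifun x.
Proof.
wlog x2 : x / 2^-1 < x => [H x01 xn|].
  have [x2|] := ltP 2^-1 x; first exact: H.
  rewrite le_eqVlt (negbTE xn)/= => x2.
  rewrite -IfunC (_ : (x - 2^-1) ^+ 2 = (1 - x - 2^-1) ^+ 2); last by field.
  by apply: H; [lra|lra|rewrite gt_eqF//; lra].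
move=> x01 _.
(* The endpoint lies outside the range of [entropy_gt]. There the claim is [ln 2 > 1/2], which
   follows from [expR t > 1 + t] at [t = - 1/2]. *)
have [->|x1] := eqVneq x 1.
  have : ln (2^-1) < - 2^-1 :> R.
    rewrite -ltr_expR lnK ?posrE//.
    have /expR_gt1Dx : - 2^-1 != 0 :> R by rewrite lt_eqF//; lra.
    lra.
  rewrite lnV ?posrE// /Ifun subrr mul0r ln1; lra.
have x1' : x < 1 by rewrite lt_neqAle x1; lra.
have -> : x = (1 + (2 * x - 1)) / 2 by field.
rewrite Ifun_entropy; last lra.
have /entropy_gt : 0 < 2 * x - 1 < 1 by lra.
nra.
Qed.

Lemma Ifun_ge (R : realType) (x : R) : 0 <= x <= 1 ->
  - ln 2 + 2 * (x - 2^-1) ^+ 2 <= Ifun x.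
Proof.
have [->|xn] := eqVneq x 2^-1; last by move=> x01; apply/ltW/Ifun_gt.
by rewrite subrr expr0n/= mulr0 addr0 Ifun_half.
Qed.

Lemma Ifun_le0 (R : realType) (x : R) : 0 <= x <= 1 -> Ifun x <= 0.
Proof.
move=> /andP[x0 x1].
have h1 : ln x <= 0 by apply: ln_le0.
have h2 : ln (1 - x) <= 0 by apply: ln_le0; lra.
rewrite /Ifun; nra.
Qed.

(** * Bounded measurable functions *)

(** A class closed under the ring operations and integrable on sets of finite measure, so that one
    hypothesis settles every integrability condition below. *)
Definition bounded_mfun {d} {T : measurableType d} {R : realType} (D : set T)
    (f : T -> R) :=
  measurable_fun D f /\ exists M, forall x, D x -> `|f x| <= M.

Section bounded_mfun.
Context {d} {T : measurableType d} {R : realType}.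
Implicit Types (D : set T) (f g : T -> R).

Lemma bounded_mfun_cst D (c : R) : bounded_mfun D (fun=> c).
Proof. by split; [exact: measurable_cst|exists `|c|]. Qed.

Lemma bounded_mfunD D f g : bounded_mfun D f -> bounded_mfun D g ->
  bounded_mfun D (fun x => f x + g x).
Proof.
move=> [mf [M fM]] [mg [N gN]]; split; first exact: measurable_funD.
by exists (M + N) => x Dx; rewrite (le_trans (ler_normD _ _))// lerD ?fM ?gN.
Qed.

Lemma bounded_mfunM D f g : bounded_mfun D f -> bounded_mfun D g ->
  bounded_mfun D (fun x => f x * g x).
Proof.
move=> [mf [M fM]] [mg [N gN]]; split; first exact: measurable_funM.
by exists (M * N) => x Dx; rewrite normrM ler_pM ?fM ?gN.
Qed.

Lemma bounded_mfunB D f g : bounded_mfun D f -> bounded_mfun D g ->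
  bounded_mfun D (fun x => f x - g x).
Proof.
move=> bf bg.
have := bounded_mfunD _ _ _ bf (bounded_mfunM _ _ _ (bounded_mfun_cst D (-1)) bg).
by under [X in bounded_mfun _ X -> _]eq_fun do rewrite mulN1r.
Qed.

Lemma bounded_mfunX2 D f : bounded_mfun D f -> bounded_mfun D (fun x => f x ^+ 2).
Proof. by move=> bf; exact: bounded_mfunM. Qed.

Lemma bounded_mfun_integrable (m : {measure set T -> \bar R}) D f :
  measurable D -> (m D < +oo)%E -> bounded_mfun D f -> m.-integrable D (EFin \o f).
Proof.
move=> mD mDoo [mf [M fM]]; apply: measurable_bounded_integrable => //.
exists M; split; first exact: num_real.
by move=> x Mx y Dy /=; rewrite (le_trans (fM _ Dy))// ltW.
Qed.

End bounded_mfun.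

(** * Integration on the unit interval and the unit square, and Fubini *)

Section square.
Context {R : realType}.
Local Notation mu := (@lebesgue_measure R).
Local Notation I := (`[0%R, 1%R]%classic : set R).
Local Notation Q := (@unit_square R).

(* The measurable structure carried by [lebesgue_measure] agrees with the
   canonical one on [R] only up to conversion, which unification does not find;
   hence the explicit measures passed to library lemmas below. *)
Lemma measurable_unit_interval : measurable I. Proof. exact: measurable_itv. Qed.

Lemma measurable_unit_square : measurable Q.
Proof. exact: (measurableX measurable_unit_interval measurable_unit_interval). Qed.

Lemma mu_I : mu I = 1%E.
Proof. by rewrite lebesgue_measure_itv/= lte_fin ltr01 sube0. Qed.

Lemma mu_Q : (mu \x mu)%E Q = 1%E.
Proof.
rewrite product_measure1E; [|exact: measurable_unit_interval..].
by rewrite [LHS](_ : _ = mu I * mu I)%E// mu_I mule1.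
Qed.

Lemma integrable_I (f : R -> R) : bounded_mfun I f -> mu.-integrable I (EFin \o f).
Proof.
have Ioo : (mu I < +oo)%E by rewrite mu_I ltry.
exact: (@bounded_mfun_integrable _ _ R mu I f measurable_unit_interval Ioo).
Qed.

Lemma integrable_Q (f : R * R -> R) :
  bounded_mfun Q f -> (mu \x mu)%E.-integrable Q (EFin \o f).
Proof.
have Qoo : ((mu \x mu)%E Q < +oo)%E by rewrite mu_Q ltry.
exact: (@bounded_mfun_integrable _ _ R (mu \x mu)%E Q f measurable_unit_square Qoo).
Qed.

Lemma integralD_I (f g : R -> R) : bounded_mfun I f -> bounded_mfun I g ->
  \int[mu]_(x in I) (f x + g x) = \int[mu]_(x in I) f x + \int[mu]_(x in I) g x.
Proof. by move=> bf bg; rewrite RintegralD//; exact: integrable_I. Qed.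

Lemma integralZ_I (c : R) (f : R -> R) : bounded_mfun I f ->
  \int[mu]_(x in I) (c * f x) = c * \int[mu]_(x in I) f x.
Proof. by move=> bf; rewrite RintegralZl//; exact: integrable_I. Qed.

Lemma integral_cst_I (c : R) : \int[mu]_(x in I) c = c.
Proof. by rewrite Rintegral_cst//= mu_I /= mulr1. Qed.

Lemma integralD_Q (f g : R * R -> R) : bounded_mfun Q f -> bounded_mfun Q g ->
  \int[(mu \x mu)%E]_(x in Q) (f x + g x) =
  \int[(mu \x mu)%E]_(x in Q) f x + \int[(mu \x mu)%E]_(x in Q) g x.
Proof.
by move=> bf bg; rewrite RintegralD//; [exact: measurable_unit_square|exact: integrable_Q..].
Qed.

Lemma integralZ_Q (c : R) (f : R * R -> R) : bounded_mfun Q f ->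
  \int[(mu \x mu)%E]_(x in Q) (c * f x) = c * \int[(mu \x mu)%E]_(x in Q) f x.
Proof.
by move=> bf; rewrite RintegralZl//; [exact: measurable_unit_square|exact: integrable_Q].
Qed.

Lemma integral_cst_Q (c : R) : \int[(mu \x mu)%E]_(x in Q) c = c.
Proof.
rewrite [RHS](_ : c = c * fine ((mu \x mu)%E Q)); last by rewrite mu_Q mulr1.
exact: (Rintegral_cst (mu \x mu)%E measurable_unit_square c).
Qed.

Lemma le_integral_Q (f g : R * R -> R) : bounded_mfun Q f -> bounded_mfun Q g ->
  (forall z, Q z -> f z <= g z) ->
  \int[(mu \x mu)%E]_(x in Q) f x <= \int[(mu \x mu)%E]_(x in Q) g x.
Proof.
move=> bf bg fg; apply: le_Rintegral => //;
  [exact: measurable_unit_square|exact: integrable_Q..].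
Qed.

Lemma section_bounded_mfun (f : R * R -> R) (x : R) : bounded_mfun Q f -> I x ->
  bounded_mfun I (fun y => f (x, y)).
Proof.
move=> [mf [M fM]] Ix; split; last by exists M => y Iy; exact: fM.
have mp : measurable_fun I (fun y : R => (x, y)) by apply: measurable_funS (pair1_measurable x).
by apply: (measurable_comp measurable_unit_square _ mf mp) => _ [y Iy <-].
Qed.

Lemma section2_bounded_mfun (f : R * R -> R) (y : R) : bounded_mfun Q f -> I y ->
  bounded_mfun I (fun x => f (x, y)).
Proof.
move=> [mf [M fM]] Iy; split; last by exists M => x Ix; exact: fM.
have mp : measurable_fun I (fun x : R => (x, y)) by apply: measurable_funS (pair2_measurable y).
by apply: (measurable_comp measurable_unit_square _ mf mp) => _ [x Ix <-].
Qed.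

Lemma bounded_mfun_fst (f : R -> R) : bounded_mfun I f ->
  bounded_mfun Q (fun z => f z.1).
Proof.
move=> [mf [M fM]]; split; last by exists M => z [Iz _]; exact: fM.
apply: (measurable_comp measurable_unit_interval _ mf) => //; first by move=> _ [z [Iz _] <-].
exact: measurable_funS measurable_fst.
Qed.

Lemma bounded_mfun_snd (f : R -> R) : bounded_mfun I f ->
  bounded_mfun Q (fun z => f z.2).
Proof.
move=> [mf [M fM]]; split; last by exists M => z [_ Iz]; exact: fM.
apply: (measurable_comp measurable_unit_interval _ mf) => //; first by move=> _ [z [_ Iz] <-].
exact: measurable_funS measurable_snd.
Qed.

(** Extension by zero, since the Fubini theorem applied here concerns the whole product space. *)
Let ext (f : R * R -> R) : R * R -> \bar R := (EFin \o f) \_ Q.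

Let integrable_ext f : bounded_mfun Q f -> (mu \x mu)%E.-integrable setT (ext f).
Proof.
move=> bf; have := integrable_Q _ bf.
exact: (@integrable_mkcond _ _ R (mu \x mu)%E Q (EFin \o f) measurable_unit_square).1.
Qed.

(** For [x] outside the interval the whole section vanishes; inside, the section is bounded, so its
    integral is finite and passing to a real value loses nothing. *)
Let sec1E f : bounded_mfun Q f -> fubini_F mu (ext f) =
  (EFin \o (fun x => \int[mu]_(y in I) f (x, y))) \_ I.
Proof.
move=> bf; apply/funext => x; rewrite /fubini_F /ext patchE.
case: ifPn => Ix.
  rewrite /= /Rintegral fineK; last first.
    apply: integrable_fin_num => //; apply: integrable_I.
    by apply: section_bounded_mfun => //; rewrite inE in Ix.
  rewrite [RHS]integral_mkcond; apply: eq_integral => y _.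
  by rewrite !patchE /unit_square in_setX Ix.
rewrite integral0_eq// => y _.
by rewrite patchE /unit_square in_setX (negbTE Ix).
Qed.

Let sec2E f : bounded_mfun Q f -> fubini_G mu (ext f) =
  (EFin \o (fun y => \int[mu]_(x in I) f (x, y))) \_ I.
Proof.
move=> bf; apply/funext => y; rewrite /fubini_G /ext patchE.
case: ifPn => Iy.
  rewrite /= /Rintegral fineK; last first.
    apply: integrable_fin_num => //; apply: integrable_I.
    by apply: section2_bounded_mfun => //; rewrite inE in Iy.
  rewrite [RHS]integral_mkcond; apply: eq_integral => x _.
  by rewrite !patchE /unit_square in_setX Iy andbT.
rewrite integral0_eq// => x _.
by rewrite patchE /unit_square in_setX (negbTE Iy) andbF.
Qed.

Lemma bounded_mfun_integral (f : R * R -> R) : bounded_mfun Q f ->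
  bounded_mfun I (fun x => \int[mu]_(y in I) f (x, y)).
Proof.
move=> bf; split.
  (* Measurability is inherited from the partial integral of the extension by zero. *)
  apply/measurable_EFinP/measurable_restrictT; first exact: measurable_unit_interval.
  rewrite -sec1E//.
  exact: (@measurable_fubini_F _ _ _ _ R mu mu _ (integrable_ext _ bf)).
have [_ [M fM]] := bf; exists M => x Ix.
have bfx := section_bounded_mfun _ _ bf Ix.
rewrite (le_trans (le_normr_Rintegral _ _))//; first exact: integrable_I.
(* The bound [M] on [f] survives integration because the interval has measure 1. *)
rewrite -[leRHS]integral_cst_I; apply: le_Rintegral => //.
- apply: integrable_I; split; last first.
    by exists M => y Iy; rewrite normr_id fM.
  by apply: measurableT_comp => //; exact: bfx.1.
- by apply: integrable_I; exact: bounded_mfun_cst.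
- by move=> y Iy; exact: fM.
Qed.

Lemma Fubini_Q (f : R * R -> R) : bounded_mfun Q f ->
  \int[(mu \x mu)%E]_(z in Q) f z = \int[mu]_(x in I) \int[mu]_(y in I) f (x, y).
Proof.
move=> bf; rewrite /Rintegral; congr fine.
rewrite integral_mkcond -(integral12_prod_meas1 (integrable_ext _ bf)).
apply: etrans; first exact: (congr1 (integral mu setT) (sec1E f bf)).
by rewrite -integral_mkcond.
Qed.

Lemma Fubini_swap_Q (f : R * R -> R) : bounded_mfun Q f ->
  \int[(mu \x mu)%E]_(z in Q) f z = \int[mu]_(y in I) \int[mu]_(x in I) f (x, y).
Proof.
move=> bf; rewrite /Rintegral; congr fine.
rewrite integral_mkcond -(integral21_prod_meas1 (integrable_ext _ bf)).
apply: etrans; first exact: (congr1 (integral mu setT) (sec2E f bf)).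
by rewrite -integral_mkcond.
Qed.

End square.

(** Follows the syntax of the expression. Subtraction is tried before addition, as it unfolds to a
    sum with an opposite, for which there is no rule. *)
Ltac solve_bounded_mfun := by repeat first
  [ eassumption | apply: bounded_mfun_cst | apply: bounded_mfun_fst
  | apply: bounded_mfun_snd | apply: bounded_mfunX2 | apply: bounded_mfunB
  | apply: bounded_mfunD | apply: bounded_mfunM ].

(** * Degrees and bounds on the two-star density *)

Section graphons.
Context {R : realType}.
Local Notation mu := (@lebesgue_measure R).
Local Notation I := (`[0%R, 1%R]%classic : set R).
Local Notation Q := (@unit_square R).
Implicit Types (f g : R -> R) (h : R * R -> R).

Lemma integral_fst f : bounded_mfun I f ->
  \int[(mu \x mu)%E]_(z in Q) f z.1 = \int[mu]_(x in I) f x.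
Proof.
move=> bf; rewrite Fubini_Q; last exact: bounded_mfun_fst.
by apply: eq_Rintegral => x _ /=; rewrite integral_cst_I.
Qed.

Lemma integral_snd f : bounded_mfun I f ->
  \int[(mu \x mu)%E]_(z in Q) f z.2 = \int[mu]_(x in I) f x.
Proof.
move=> bf; rewrite Fubini_swap_Q; last exact: bounded_mfun_snd.
by apply: eq_Rintegral => x _ /=; rewrite integral_cst_I.
Qed.

Lemma integral_fst_snd f g : bounded_mfun I f -> bounded_mfun I g ->
  \int[(mu \x mu)%E]_(z in Q) (f z.1 * g z.2) =
  \int[mu]_(x in I) f x * \int[mu]_(x in I) g x.
Proof.
move=> bf bg; rewrite Fubini_Q; last solve_bounded_mfun.
under eq_Rintegral do rewrite /= integralZ_I// mulrC.
by rewrite integralZ_I// mulrC.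
Qed.

Lemma bounded_mfun_graphon h : graphon h -> bounded_mfun Q h.
Proof.
move=> [mh h01 _]; split => //; exists 1 => z /h01 /andP[h0 h1].
by rewrite ger0_norm.
Qed.

Lemma bounded_mfun_Ifun h : graphon h -> bounded_mfun Q (fun z => Ifun (h z)).
Proof.
move=> [mh h01 _]; split.
  have m1 : measurable_fun setT (@Ifun R).
    apply: measurable_funD; apply: measurable_funM => //.
    - exact: measurable_funB.
    - apply: measurableT_comp; first exact: measurable_ln.
      exact: measurable_funB.
  exact: (measurableT_comp m1 mh).
(* On the unit interval [Ifun] takes values between [- ln 2] and 0. *)
exists (ln 2) => z /h01 hz; rewrite ler_norml.
have := Ifun_ge R _ hz; have := Ifun_le0 R _ hz.
have : 0 <= ln 2 :> R by rewrite ln_ge0// ler1n.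
have := sqr_ge0 (h z - 2^-1).
lra.
Qed.

(** Not centred: on the unit interval, the function d of the outline is [degree h - 1/2]. *)
Definition degree h x := \int[mu]_(y in I) h (x, y).

Lemma two_starE h : two_star_density h = \int[mu]_(x in I) (degree h x) ^+ 2.
Proof. by []. Qed.

Lemma edge_densityE h : graphon h -> edge_density h = \int[mu]_(x in I) degree h x.
Proof. by move=> /bounded_mfun_graphon bh; rewrite /edge_density Fubini_Q. Qed.

(** The degree has mean 1/2, and its variance is nonnegative. *)
Lemma two_star_ge h : admissible 2^-1 h -> 4^-1 <= two_star_density h.
Proof.
move=> [gh eh]; rewrite two_starE; rewrite (edge_densityE _ gh) in eh.
have bd : bounded_mfun I (degree h).
  by apply: bounded_mfun_integral; exact: bounded_mfun_graphon.
have : 0 <= \int[mu]_(x in I) ((degree h x - 2^-1) ^+ 2).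
  by apply: Rintegral_ge0 => x _; exact: sqr_ge0.
have -> : \int[mu]_(x in I) ((degree h x - 2^-1) ^+ 2) =
    \int[mu]_(x in I) (degree h x ^+ 2 + (-1 * degree h x + 4^-1)).
  by apply: eq_Rintegral => x _; field.
rewrite !(integralD_I, integralZ_I, integral_cst_I) ?eh; try solve_bounded_mfun.
lra.
Qed.

(** Since [two_star_density h - 1/4] is the integral of d squared, this is the inequality between d
    and g in the outline; [h - degree h x - degree h y + 1/2] is g - d(x) - d(y). *)
Lemma two_star_le h : admissible 2^-1 h ->
  2 * (two_star_density h - 4^-1) <=
  \int[(mu \x mu)%E]_(z in Q) (h z - 2^-1) ^+ 2.
Proof.
move=> [gh eh]; have [_ _ hC] := gh; have bh := bounded_mfun_graphon _ gh.
have e1 := eh; rewrite (edge_densityE _ gh) in e1.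
have bd : bounded_mfun I (degree h) by apply: bounded_mfun_integral.
set A := two_star_density h.
have hd1 : \int[(mu \x mu)%E]_(z in Q) (degree h z.1 * h z) = A.
  rewrite Fubini_Q; last solve_bounded_mfun.
  apply: eq_Rintegral => x; rewrite inE => Ix /=.
  by rewrite integralZ_I ?expr2//; apply: section_bounded_mfun.
(* Here [x] is integrated first, and symmetry of [h] turns the inner integral into the degree of
   [y]. *)
have hd2 : \int[(mu \x mu)%E]_(z in Q) (degree h z.2 * h z) = A.
  rewrite Fubini_swap_Q; last solve_bounded_mfun.
  apply: eq_Rintegral => y; rewrite inE => Iy /=.
  rewrite integralZ_I ?expr2//; last by apply: section2_bounded_mfun.
  congr (_ * _); apply: eq_Rintegral => x; rewrite inE => Ix.
  by apply: hC.
(* A lower bound for [(h z - 1/2) ^+ 2], as the square of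
   [h (x, y) - degree h x - degree h y + 1/2] is nonnegative. *)
pose k z := 2 * (degree h z.1 * h z) + (2 * (degree h z.2 * h z) +
  (-2 * h z + (degree h z.1 + (degree h z.2 + (-1 * degree h z.1 ^+ 2 +
  (-1 * degree h z.2 ^+ 2 + -2 * (degree h z.1 * degree h z.2))))))).
have <- : \int[(mu \x mu)%E]_(z in Q) k z = 2 * (A - 4^-1).
  rewrite /k !(integralD_Q, integralZ_Q); try solve_bounded_mfun.
  rewrite hd1 hd2 !(integral_fst (degree h)) ?(integral_snd (degree h))//.
  rewrite (integral_fst (fun x => degree h x ^+ 2)); last solve_bounded_mfun.
  rewrite (integral_snd (fun x => degree h x ^+ 2)); last solve_bounded_mfun.
  rewrite integral_fst_snd// -two_starE -/A e1 [X in -2 * X]eh.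
  by field.
apply: le_integral_Q; [by rewrite /k; solve_bounded_mfun|solve_bounded_mfun|].
move=> z _.
have := sqr_ge0 (h z - degree h z.1 - degree h z.2 + 2^-1).
rewrite /k; lra.
Qed.

(** * The constant graphon 1/2 and uniformity up to 2 *)

Lemma objective_half beta : objective beta (fun=> 2^-1 : R) = beta / 4 + ln 2 / 2.
Proof.
rewrite /objective /two_star_density.
under eq_Rintegral do rewrite integral_cst_I.
by rewrite integral_cst_I integral_cst_Q Ifun_half; field.
Qed.

Lemma admissible_half : admissible 2^-1 (fun=> 2^-1 : R).
Proof.
split; last exact: integral_cst_Q.
split=> [|z _|//]; first exact: measurable_cst.
by apply/andP; split; lra.
Qed.

Lemma objective_le_psi e beta h : admissible e h ->
  ((objective beta h)%:E <= psi e beta)%E.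
Proof. by move=> ah; apply: ereal_sup_ubound; exists h. Qed.

Lemma ae_squareS (P P' : set (R * R)) : P `<=` P' ->
  {ae (mu \x mu)%E, forall z, P z} -> {ae (mu \x mu)%E, forall z, P' z}.
Proof.
move=> PP'; have F := @ae_filter_ringOfSetsType _ _ R (mu \x mu)%E.
exact: (@filterS _ _ F).
Qed.

Lemma ge0_integral_eq0 h : bounded_mfun Q h -> (forall z, Q z -> 0 <= h z) ->
  \int[(mu \x mu)%E]_(z in Q) h z <= 0 ->
  {ae (mu \x mu)%E, forall z, Q z -> h z = 0}.
Proof.
move=> bh h0 hle.
have hint := integrable_Q _ bh.
(* Finiteness matters: [fine] sends infinite values to 0, so the real bound alone would not control
   the extended integral. *)
have fin := @integrable_fin_num _ _ R (mu \x mu)%E Q measurable_unit_square _ hint.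
have i0 : (\int[(mu \x mu)%E]_(z in Q) `|(EFin \o h) z| = 0)%E.
  transitivity (\int[(mu \x mu)%E]_(z in Q) (EFin \o h) z)%E.
    by apply: eq_integral => z; rewrite inE => Qz; rewrite /= ger0_norm// h0.
  apply/eqP; rewrite eq_le; apply/andP; split.
    by rewrite -(fineK fin) lee_fin.
  by apply: integral_ge0 => z Qz; rewrite lee_fin h0.
have mh := measurable_int _ hint.
have := (@ae_eq_integral_abs _ _ R (mu \x mu)%E Q measurable_unit_square _ mh).1 i0.
apply: ae_squareS => z hz Qz.
by have [] := hz Qz.
Qed.

Lemma ae_eq_integral_Q h h' : bounded_mfun Q h -> bounded_mfun Q h' ->
  {ae (mu \x mu)%E, forall z, Q z -> h z = h' z} ->
  \int[(mu \x mu)%E]_(z in Q) h z = \int[(mu \x mu)%E]_(z in Q) h' z.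
Proof.
move=> /integrable_Q/measurable_int mh /integrable_Q/measurable_int mh' hh'.
have hhE : {ae (mu \x mu)%E, forall z, Q z -> (h z)%:E = (h' z)%:E}.
  by apply: ae_squareS hh' => z hz Qz; rewrite hz.
congr fine.
exact: (@ae_eq_integral _ _ R (mu \x mu)%E Q _ _ measurable_unit_square mh mh' hhE).
Qed.

Lemma uniform_le2 (beta : R) : beta <= 2 -> @optimizer_uniform R 2^-1 beta.
Proof.
move=> b2 h [ah hpsi]; have [gh _] := ah; have [_ h01 _] := gh.
have bh := bounded_mfun_graphon _ gh; have bI := bounded_mfun_Ifun _ gh.
(* Optimality enters only through the comparison with the constant 1/2. *)
have := objective_le_psi _ beta _ admissible_half.
rewrite -hpsi lee_fin objective_half /objective.
set A := two_star_density h; set J := \int[_]_(_ in _) _ => AJ.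
have A1 := two_star_ge _ ah; have A2 := two_star_le _ ah.
rewrite -/A in A1 A2.
exists 2^-1.
(* The pointwise slack in the quadratic bound on [Ifun]. It is nonnegative, so it vanishes almost
   everywhere once its integral is at most 0. *)
pose W z := Ifun (h z) + (ln 2 + -2 * (h z - 2^-1) ^+ 2).
have bW : bounded_mfun Q W by rewrite /W; solve_bounded_mfun.
have : {ae (mu \x mu)%E, forall z, Q z -> W z = 0}.
  apply: ge0_integral_eq0 => //.
    by move=> z /h01 /Ifun_ge; rewrite /W; lra.
  rewrite integralD_Q -/J; [|by []|by solve_bounded_mfun].
  rewrite !(integralD_Q, integralZ_Q, integral_cst_Q); try solve_bounded_mfun.
  (* The comparison gives [J + ln 2 <= 2 * beta * (A - 1/4)], and [A2] bounds the quadratic term, so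
     the integral of [W] is at most [-2 * (2 - beta) * (A - 1/4)]. *)
  have : 0 <= (2 - beta) * (A - 4^-1) by apply: mulr_ge0; lra.
  lra.
apply: ae_squareS => z Wz Qz; apply/eqP; apply: contraT => hz.
have := Ifun_gt R _ (h01 _ Qz) hz; have := Wz Qz; rewrite /W.
lra.
Qed.

(** The edge density forces the constant to be 1/2. As [beta >= 0], an upper bound on the two-star
    density suffices: [two_star_le] with zero right-hand side gives 1/4, with no need to pass from a
    null set of the square to its sections. *)
Lemma ae_constant_objective_le (beta : R) h : 0 <= beta -> admissible 2^-1 h ->
  ae_constant h -> objective beta h <= beta / 4 + ln 2 / 2.
Proof.
move=> b0 ah [c hc]; have [gh eh] := ah.
have bh := bounded_mfun_graphon _ gh; have bI := bounded_mfun_Ifun _ gh.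
have bc (r : R) := bounded_mfun_cst Q r.
have c2 : c = 2^-1.
  by rewrite -eh /edge_density (ae_eq_integral_Q _ _ bh (bc c) hc) integral_cst_Q.
have A2 := two_star_le _ ah.
rewrite (ae_eq_integral_Q _ (fun=> 0)) ?integral_cst_Q// in A2; first last.
- by apply: ae_squareS hc => z hz Qz; rewrite hz// c2 subrr expr0n.
- solve_bounded_mfun.
rewrite /objective (ae_eq_integral_Q _ (fun=> Ifun 2^-1)) ?integral_cst_Q//; last first.
  by apply: ae_squareS hc => z hz Qz; rewrite hz// c2.
rewrite Ifun_half; nra.
Qed.

(** * The sign perturbation and non-uniformity beyond 2 *)

Lemma balanced_sign : exists s : R -> R, [/\ bounded_mfun I s,
  (forall x, s x = 1 \/ s x = -1) & \int[mu]_(x in I) s x = 0].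
Proof.
pose J : set R := `[0, 2^-1]%classic.
have mJ : measurable J by exact: measurable_itv.
have b1 : bounded_mfun I (\1_J : R -> R).
  split; first exact: measurable_indic.
  by exists 1 => x _; rewrite indicE; case: (_ \in _); rewrite ?normr0 ?normr1.
exists (fun x => 2 * \1_J x - 1); split; first by solve_bounded_mfun.
  by move=> x; rewrite indicE; case: (_ \in _); [left|right];
    rewrite ?mulr1 ?mulr0; lra.
rewrite integralD_I; [|solve_bounded_mfun..].
rewrite integralZ_I// integral_cst_I.
have -> : \int[mu]_(x in I) \1_J x = 2^-1.
  rewrite /Rintegral integral_indic//.
  rewrite setIidl.
    by rewrite /= lebesgue_measure_itv/= lte_fin ifT ?oppr0 ?addr0//; lra.
  by move=> x; rewrite /J/= !in_itv/=; lra.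
by field.
Qed.

Section perturbation.
Context (s : R -> R).
Context (bs : bounded_mfun I s) (sE : forall x, s x = 1 \/ s x = -1).
Context (s0 : \int[mu]_(x in I) s x = 0).

Definition perturbation (eps : R) (z : R * R) : R :=
  2^-1 + eps * (s z.1 + s z.2).

Lemma bounded_mfun_perturbation eps : bounded_mfun Q (perturbation eps).
Proof. by rewrite /perturbation; solve_bounded_mfun. Qed.

Lemma admissible_perturbation (eps : R) : 0 <= eps <= 4^-1 ->
  admissible 2^-1 (perturbation eps).
Proof.
move=> e01; have bp := bounded_mfun_perturbation eps.
split.
  split; first exact: bp.1.
    move=> [x y] _; rewrite /perturbation /=.
    (* The values are 1/2 and [1/2 + 2 * eps], [1/2 - 2 * eps], whence the condition
       [eps <= 1/4]. *)
    by case: (sE x) => ->; case: (sE y) => ->; lra.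
  by move=> x y _; rewrite /perturbation/= [s x + _]addrC.
rewrite /edge_density /perturbation.
rewrite !(integralD_Q, integralZ_Q, integral_cst_Q); try solve_bounded_mfun.
by rewrite (integral_fst s)// (integral_snd s)// s0; field.
Qed.

Lemma two_star_perturbation eps :
  two_star_density (perturbation eps) = 4^-1 + eps ^+ 2.
Proof.
rewrite two_starE.
(* The degree is [1/2 + eps * s x], and the square of [s x] is 1. *)
have -> : \int[mu]_(x in I) degree (perturbation eps) x ^+ 2 =
    \int[mu]_(x in I) (4^-1 + eps ^+ 2 + eps * s x).
  apply: eq_Rintegral => x _; rewrite /degree /perturbation/=.
  rewrite !(integralD_I, integralZ_I, integral_cst_I); try solve_bounded_mfun.
  by rewrite s0; case: (sE x) => ->; field.
rewrite !(integralD_I, integralZ_I, integral_cst_I); try solve_bounded_mfun.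
by rewrite s0 mulr0 addr0.
Qed.

Lemma integral_Ifun_perturbation (u : R) : 0 < u < 1 ->
  \int[(mu \x mu)%E]_(z in Q) Ifun (perturbation (u / 4) z) =
  - ln 2 + ((1 + u) * ln (1 + u) + (1 - u) * ln (1 - u)) / 4.
Proof.
move=> u01; set J := _ + _ * ln (1 - u).
(* With [eps = u / 4] the values are [(1 + u) / 2], 1/2 and [(1 - u) / 2]. The integrand depends
   only on whether the two signs agree, so it is affine in their product, whose integral is 0. *)
have -> : \int[(mu \x mu)%E]_(z in Q) Ifun (perturbation (u / 4) z) =
    \int[(mu \x mu)%E]_(z in Q) (- ln 2 + J / 4 + J / 4 * (s z.1 * s z.2)).
  apply: eq_Rintegral => -[x y] _; rewrite /perturbation/=.
  have Ju : Ifun ((1 + u) / 2) = J / 2 - ln 2 by apply: Ifun_entropy; lra.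
  case: (sE x) => ->; case: (sE y) => ->.
  - rewrite (_ : _ + _ = (1 + u) / 2); last by field.
    by rewrite Ju; field.
  - by rewrite subrr mulr0 addr0 Ifun_half; field.
  - by rewrite addrC addNr mulr0 add0r Ifun_half; field.
  - rewrite (_ : _ + _ = 1 - (1 + u) / 2); last by field.
    by rewrite IfunC Ju; field.
rewrite !(integralD_Q, integralZ_Q, integral_cst_Q); try solve_bounded_mfun.
by rewrite integral_fst_snd// s0 !mulr0 addr0.
Qed.

End perturbation.

Lemma nonuniform_gt2 (beta : R) : 2 < beta -> @optimizer_nonuniform R 2^-1 beta.
Proof.
move=> b2 h [ah hpsi] hc.
have hle : objective beta h <= beta / 4 + ln 2 / 2.
  by apply: ae_constant_objective_le => //; lra.
(* With E the left-hand side, the perturbation gains [(beta / 2 * u ^+ 2 - E) / 8] over the constant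
   1/2; [beta > 2] makes [l = beta / 2] exceed 1, so some [u] makes this positive. *)
have [u u01 Ju] : exists2 u : R, 0 < u < 1 & (1 + u) * ln (1 + u) +
    (1 - u) * ln (1 - u) < beta / 2 * u ^+ 2 by apply: entropy_lt; lra.
have [s [bs sE s0]] := balanced_sign.
have ap : admissible 2^-1 (perturbation s (u / 4)).
  by apply: admissible_perturbation => //; lra.
have := objective_le_psi _ beta _ ap.
rewrite -hpsi lee_fin /(objective _ (perturbation _ _)).
rewrite two_star_perturbation//.
rewrite (integral_Ifun_perturbation _ bs sE s0 _ u01).
lra.
Qed.

End graphons.

Theorem proposition18 (R : realType) (beta2 : R) :
  (beta2 <= 2 -> optimizer_uniform 2^-1 beta2) /\
  (2 < beta2 -> optimizer_nonuniform 2^-1 beta2).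
Proof. by split; [exact: uniform_le2|exact: nonuniform_gt2]. Qed.
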